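(* Let $G$ be a group and $(\theta,\mathcal S)\in\mathsf{pA}(G,\mathsf{Sem})$ such that $D_x$ is an ideal of $S$ for all $x\in G$. Each one of the following assumptions is sufficient for $(\theta,\mathcal S)$ to have a globalization in $\mathsf A(G,\mathsf{Sem})$: (i) $\mathcal D_x$ is idempotent for all $x\in G\setminus\{1\}$; (ii) $\mathcal D_x$ is weakly reductive for all $x\in G\setminus\{1\}$. In particular, (i) (as well as (ii)) is true when $\mathcal S$ is inverse or each $\mathcal D_x$ is unital.
   Context: A partial action of a group $G$ on a set $S$ is a partial map $\theta:G\times S\dashrightarrow S$ such that for all $x,y\in G$, $a\in S$: (i) $\theta(1,a)$ is defined and equals $a$; (ii) if $\theta(x,a)$ is defined, then $\theta(x^{-1},\theta(x,a))$ is defined and equals $a$; (iii) if $\theta(y,a)$ and $\theta(x,\theta(y,a))$ are defined, then $\theta(xy,a)$ is defined and equals $\theta(x,\theta(y,a))$. It is global if everywhere defined. The domain $D_x$ is $\{\theta(x,a)\mid a\in S,\ \theta(x,a)\text{ defined}\}$, and $\theta_x=\theta(x,-)$ is a bijection $D_{x^{-1}}\to D_x$. $\mathsf{Sem}$ is the variety of semigroups. $\mathsf{pA}(G,\mathsf{Sem})$ is the category of pairs $(\theta,\mathcal S)$ with $\mathcal S=(S,\cdot)$ a semigroup and $\theta$ a partial action of $G$ on the set $S$ such that every $D_x$ is a subsemigroup $\mathcal D_x$ of $\mathcal S$ and every $\theta_x:\mathcal D_{x^{-1}}\to\mathcal D_x$ is an isomorphism of semigroups. Morphisms $(\theta,\mathcal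 S)\to(\theta',\mathcal S')$ are semigroup homomorphisms $\varphi$ such that whenever $\theta(x,a)$ is defined, $\theta'(x,\varphi(a))$ is defined and equals $\varphi(\theta(x,a))$. $\mathsf A(G,\mathsf{Sem})$ is the full subcategory of pairs with global $\theta$. A globalization of $(\theta,\mathcal S)$ in $\mathsf A(G,\mathsf{Sem})$ is $(\vartheta,\mathcal T)\in\mathsf A(G,\mathsf{Sem})$ with an injective morphism $\iota:(\theta,\mathcal S)\to(\vartheta,\mathcal T)$ such that for all $x\in G$, $a\in S$: $\theta(x,a)$ is defined iff $\vartheta(x,\iota(a))\in\iota(S)$. Ideals are two-sided. A semigroup $D$ is idempotent if $D^2=D$; it is weakly reductive if for all $a,b\in D$, $ca=cb$ and $ac=bc$ for all $c\in D$ imply $a=b$; it is unital if it has an identity element. A semigroup is inverse if every element $s$ has a unique element $s^{-1}$ with $ss^{-1}s=s$ and $s^{-1}ss^{-1}=s^{-1}$. *)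

(* Defs.v *)
(* [groupType] and [semigroupType] are arbitrary, possibly infinite, groups    *)
(* and semigroups; the [choiceType] structure they carry is no restriction,    *)
(* since classically every type has one.                                       *)
From HB Require Import structures.
From mathcomp Require Import all_boot monoid.
From mathcomp Require Import boolp classical_sets.

Set Implicit Arguments.
Unset Strict Implicit.
Unset Printing Implicit Defensive.

Local Open Scope classical_set_scope.
Local Open Scope group_scope.

(* A partial map G x S --> S is a function to [option S]: [theta x a = Some b] *)
(* says that theta(x, a) is defined and equals b.                              *)
Record is_partial_action (G : groupType) (S : Type)
    (theta : G -> S -> option S) : Prop := IsPartialAction {
  pact1 : forall a, theta 1 a = Some a;
  pactV : forall x a b, theta x a = Some b -> theta x^-1 b = Some a;
  pactM : forall x y a b c,
    theta y a = Some b -> theta x b = Some c -> theta (x * y) a = Some c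
}.

Definition pdom (G : groupType) (S : Type) (theta : G -> S -> option S)
  (x : G) : set S := [set b | exists a, theta x a = Some b].

Section Subsemigroups.
Variable S : semigroupType.
Implicit Types D E : set S.

(* The empty set is allowed as a subsemigroup and as an ideal. *)
Definition subsemigroup D := forall a b, D a -> D b -> D (a * b).

Definition two_sided_ideal D := forall s a, D a -> D (s * a) /\ D (a * s).

Definition idempotent_semigroup D := [set a * b | a in D & b in D] = D.

Definition weakly_reductive D := forall a b, D a -> D b ->
  (forall c, D c -> c * a = c * b /\ a * c = b * c) -> a = b.

Definition unital D :=
  exists2 e, D e & forall a, D a -> e * a = a /\ a * e = a.

(* The partial map f is a semigroup isomorphism from D onto E.  For f = theta_x *)
(* all clauses but the last already follow from the axioms of partial actions.  *)
Record sg_iso D E (f : S -> option S) : Prop := SgIso {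
  sg_iso_dom : forall a, (exists b, f a = Some b) <-> D a;
  sg_iso_codom : forall b, (exists a, f a = Some b) <-> E b;
  sg_iso_inj : forall a a' b, f a = Some b -> f a' = Some b -> a = a';
  sg_isoM : forall a a' b b',
    f a = Some b -> f a' = Some b' -> f (a * a') = Some (b * b')
}.

End Subsemigroups.

Definition inverse_semigroup (S : semigroupType) :=
  forall s : S, exists! t : S, s * t * s = s /\ t * s * t = t.

(* The objects (theta, S) of pA(G, Sem). *)
Record pactSem (G : groupType) := PactSem {
  pact_sg :> semigroupType;
  pact : G -> pact_sg -> option pact_sg;
  pact_partial : is_partial_action pact;
  pact_subsg : forall x, subsemigroup (pdom pact x);
  pact_iso : forall x, sg_iso (pdom pact x^-1) (pdom pact x) (pact x)
}.

Arguments pact {G} p x a : rename.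

Section Globalization.
Variable G : groupType.
Implicit Types P Q : pactSem G.

(* A(G, Sem) is the full subcategory of the objects satisfying this. *)
Definition is_global P := forall x a, exists b, pact P x a = Some b.

Definition is_pact_morphism P Q (phi : {multiplicative P -> Q}) :=
  forall x a b, pact P x a = Some b -> pact Q x (phi a) = Some (phi b).

Definition is_globalization P Q (iota : {multiplicative P -> Q}) :=
  [/\ is_global Q, is_pact_morphism iota, injective iota &
      forall x a, (exists b, pact P x a = Some b) <->
                  (exists2 t, pact Q x (iota a) = Some t & range iota t)].

Definition has_globalization P :=
  exists Q (iota : {multiplicative P -> Q}), is_globalization iota.

End Globalization.

(* Main.v *)
Require Import Defs.
From HB Require Import structures.
From mathcomp Require Import all_boot monoid.
From mathcomp Require Import boolp classical_sets.
From Stdlib Require Import Relation_Operators.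

(** Let S_x, for x in G, be copies of S, and glue them along the partial
    action: the point a of S_x is identified with the point theta(y^-1 x, a) of
    S_y whenever the latter is defined.  The group G permutes the set A so
    obtained, S embeds in A as S_1, and two elements of A that lie in a common
    S_x have a product there.  This product does not depend on x, because each
    theta_x is multiplicative.  What is missing is a product for the other
    pairs, and it is supplied freely: words over A are considered up to the
    congruence generated by f g = h whenever h is the product of f and g in
    some S_x.

    The point to prove is that distinct letters are not identified.  The
    rewriting rule f g -> h shortens words, and its only critical pairs come
    from words f g k with f, g in S_x and g, k in S_y.  Since g lies in the
    intersection of S_x and S_y, which corresponds to a domain D_z and hence is
    an ideal of both copies, the products (f g) k and f (g k) are again
    defined; they are equal exactly when, for all a, b, c in S with theta_z(b)
    defined,
      theta_z(a theta_z^-1(theta_z(b) c)) = theta_z(a b) c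
    ([compatible]).  Under this condition rewriting is confluent ([diamond]),
    and a letter, being irreducible, is congruent to no other letter
    ([cong_letter]).  The sets of words, with the product saturated under the
    congruence, then form a global object in which S embeds as the classes of
    the letters of S_1 ([globalization_of_compatible]).

    For z = 1 the displayed identity is associativity in S; otherwise it
    follows from either assumption.  If D_(z^-1) is idempotent, write b = b1 b2:
    both sides become theta_z(a b1) theta_z(b2) c.  If D_z is weakly reductive,
    it is enough to compare the two sides after multiplication by an arbitrary
    d = theta_z(d0) on the left and on the right.  The factors d0 a and c d then
    lie in the ideals D_(z^-1) and D_z, so that theta_z or its inverse can be
    applied to them separately, and multiplicativity gives the equality.

    If S is inverse, then a = a (a^-1 a) shows that every ideal is idempotent;
    for weak reductivity see [inverse_weakly_reductive].  An identity of D_x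
    serves both as a factor and as a test element c. *)

Set Implicit Arguments.
Unset Strict Implicit.
Unset Printing Implicit Defensive.

Local Open Scope classical_set_scope.
Local Open Scope group_scope.

(** * Points of the glued copies of S *)

Section Points.
Variables (G : groupType) (P : pactSem G).
Implicit Types (x y z : G) (a b c : P).

(** An equality of partial elements: either both sides are undefined or they
    agree.  The axioms only give it from left to right. *)
Lemma pact_comp x y a b : pact P y a = Some b -> pact P x b = pact P (x * y) a.
Proof.
have PP := pact_partial P => yab.
case xb: (pact P x b) => [c|]; first by rewrite (pactM PP yab xb).
case xya: (pact P (x * y) a) => [c|] //.
have := pactM PP (pactV PP yab) xya.
by rewrite -mulgA mulgV mulg1 xb.
Qed.

(** A point of the glued copies is encoded by its coordinates: to y is
    associated the coordinate in S_y, if the point lies in S_y. *)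
Definition letter : Type := G -> option P.

Definition pt x a : letter := fun y => pact P (y^-1 * x) a.

Lemma pt_self x a : pt x a x = Some a.
Proof. by rewrite /pt mulVg (pact1 (pact_partial P)). Qed.

Lemma pt_eqP x y a b : pact P (y^-1 * x) a = Some b <-> pt x a = pt y b.
Proof.
split=> [xyab|/(congr1 (fun f : letter => f y))]; last by rewrite pt_self.
apply/funext => z; rewrite /pt (pact_comp _ xyab).
by rewrite mulgA mulgK.
Qed.

Definition shift x (f : letter) : letter := fun y => f (x^-1 * y).

Lemma shift_pt x y a : shift x (pt y a) = pt (x * y) a.
Proof. by apply/funext => z; rewrite /shift /pt invgM invgK mulgA. Qed.

Lemma shift1 : shift 1 =1 id.
Proof. by move=> f; apply/funext => y; rewrite /shift invg1 mul1g. Qed.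

Lemma shiftM x y f : shift x (shift y f) = shift (x * y) f.
Proof. by apply/funext => z; rewrite /shift invgM mulgA. Qed.

(** The partial multiplication of the glued copies, as a relation. *)
Definition pt_mul (f g h : letter) : Prop :=
  exists x a b, [/\ f = pt x a, g = pt x b & h = pt x (a * b)].

Lemma pt_mul_shift x f g h :
  pt_mul f g h -> pt_mul (shift x f) (shift x g) (shift x h).
Proof.
move=> [y [a [b [-> -> ->]]]]; exists (x * y), a, b.
by rewrite !shift_pt.
Qed.

Lemma pt_mul_fun f g h h' : pt_mul f g h -> pt_mul f g h' -> h = h'.
Proof.
move=> [x [a [b [-> -> ->]]]] [y [a' [b' [/pt_eqP aa' /pt_eqP bb' ->]]]].
by apply/pt_eqP; apply: (sg_isoM (pact_iso _ _)).
Qed.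

End Points.

(** * Confluence *)

(** This is associativity for three points of the glued copies: a lies in one
    copy, c in a second one, and b in their intersection. *)
Definition compatible (G : groupType) (P : pactSem G) : Prop :=
  forall (z : G) (a b b' c e e' : P),
    pact P z b = Some b' -> pact P z (a * b) = Some e ->
    pact P z e' = Some (b' * c) -> pact P z (a * e') = Some (e * c).

Section Words.
Variables (G : groupType) (P : pactSem G).
Hypothesis hideal : forall x : G, two_sided_ideal (pdom (pact P) x).
Hypothesis hcompat : compatible P.

Local Notation A := (letter P).
Implicit Types (f g h k l : A) (u v w : seq A).

Lemma pact_idealr x a b b' :
  pact P x b = Some b' -> exists e, pact P x (a * b) = Some e.
Proof.
move=> xb; apply/(sg_iso_dom (pact_iso P x)).
apply: (proj1 (hideal _ _)).
by apply/(sg_iso_dom (pact_iso P x)); exists b'.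
Qed.

Lemma pt_mulA f g h k l : pt_mul f g h -> pt_mul g k l ->
  exists2 m, pt_mul h k m & pt_mul f l m.
Proof.
move=> [x [a [b [-> gE ->]]]] [y [b' [c [gE' -> ->]]]].
have zb : pact P (y^-1 * x) b = Some b' by apply/pt_eqP; rewrite -gE.
have [e ze] := pact_idealr a zb.
have [e' ze'] : exists e', pact P (y^-1 * x) e' = Some (b' * c).
  by apply: (proj2 (hideal _ _)); exists b.
exists (pt y (e * c)).
  by exists y, e, c; split=> //; apply/pt_eqP.
exists x, a, e'; split=> //; first by apply/esym/pt_eqP.
by apply/esym/pt_eqP; apply: hcompat zb ze ze'.
Qed.

Inductive step : seq A -> seq A -> Prop :=
| step_head f g h w : pt_mul f g h -> step [:: f, g & w] (h :: w)
| step_cons f u v : step u v -> step (f :: u) (f :: v).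

Lemma step_catl w u v : step u v -> step (w ++ u) (w ++ v).
Proof. by move=> uv; elim: w => //= f w; apply: step_cons. Qed.

Lemma step_catr w u v : step u v -> step (u ++ w) (v ++ w).
Proof. by elim=> /= *; [apply: step_head | apply: step_cons]. Qed.

Lemma step_shift x u v : step u v -> step (map (shift x) u) (map (shift x) v).
Proof.
by elim=> /= *; [apply/step_head/pt_mul_shift | apply: step_cons].
Qed.

Lemma diamond_head f g h w v : pt_mul f g h -> step (g :: w) v ->
  exists2 t, step (h :: w) t & step (f :: v) t.
Proof.
move=> fgh; move E: (g :: w) => u uv.
case: uv E => [g' k l w' gkl|g' w' v' w'v'] [? ?]; subst.
  have [m hkm flm] := pt_mulA fgh gkl.
  by exists (m :: w'); apply: step_head.
by exists (h :: v'); [apply: step_cons | apply: step_head].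
Qed.

(** Overlapping reductions are joined by associativity, disjoint ones commute. *)
Lemma diamond w u v : step w u -> step w v ->
  u = v \/ exists2 t, step u t & step v t.
Proof.
move=> wu; elim: wu v => {w u} [f g h w fgh|f w u wu IH] v.
  move E: [:: f, g & w] => w0 w0v.
  case: w0v E => [f' g' h' w' fgh'|f' w' v' w'v'] [].
    by move=> ? ? ?; subst; left; rewrite (pt_mul_fun fgh fgh').
  move=> ? ?; subst.
  by right; apply: diamond_head w'v'.
move E: (f :: w) => w0 w0v.
case: w0v E => [f' g' h' w' fgh'|f' w' v' w'v'] [? ?]; subst.
  by have [t] := diamond_head fgh' wu; right; exists t.
have [->|[t ut vt]] := IH _ w'v'; [by left | right].
by exists (f' :: t); apply: step_cons.
Qed.

Inductive reduces_to f : seq A -> Prop :=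
| reduces_refl : reduces_to f [:: f]
| reduces_step w v : step w v -> reduces_to f v -> reduces_to f w.

Lemma step_letter f v : ~ step [:: f] v.
Proof.
move E: [:: f] => w wv; case: wv E => [//|f' u u' uu' [_ uE]].
by rewrite -uE in uu'; inversion uu'.
Qed.

Lemma step_reduces f w v : step w v -> reduces_to f w -> reduces_to f v.
Proof.
move=> wv red; elim: red v wv => [v /step_letter //|{}w u wu redu IH v wv].
have [<- //|[t ut vt]] := diamond wu wv.
by apply: reduces_step vt _; apply: IH.
Qed.

(** * Words up to congruence *)

Definition cong : seq A -> seq A -> Prop := clos_refl_sym_trans _ step.

Lemma cong_sym u v : cong u v -> cong v u.
Proof. exact: rst_sym. Qed.

Lemma cong_trans v u w : cong u v -> cong v w -> cong u w.
Proof. exact: rst_trans. Qed.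

Lemma cong_homo (F : seq A -> seq A) u v :
  (forall u' v', step u' v' -> step (F u') (F v')) ->
  cong u v -> cong (F u) (F v).
Proof.
move=> FP; elim=> {u v} [u v uv|u|u v _|u v w _ uv _ vw].
- exact/rst_step/FP.
- exact: rst_refl.
- exact: cong_sym.
- exact: cong_trans uv vw.
Qed.

Lemma cong_cat u u' v v' : cong u u' -> cong v v' -> cong (u ++ v) (u' ++ v').
Proof.
move=> uu' vv'; apply: (@cong_trans (u' ++ v)).
  by apply: (cong_homo (F := cat^~ v)) uu' => *; apply: step_catr.
by apply: cong_homo vv' => *; apply: step_catl.
Qed.

Lemma cong_shift x u v :
  cong u v -> cong (map (shift x) u) (map (shift x) v).
Proof. by apply: cong_homo => *; apply: step_shift. Qed.

Lemma cong_reduces f u v : cong u v -> reduces_to f u <-> reduces_to f v.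
Proof.
elim=> {u v} [u v uv|u|u v _ IH|u v w _ IH1 _ IH2] //.
- by split; [apply: step_reduces | apply: reduces_step].
- by split=> /IH.
- by rewrite IH1.
Qed.

(** A letter reduces to itself only, and reducing to a given letter is invariant
    under the congruence. *)
Lemma cong_letter f g : cong [:: f] [:: g] -> f = g.
Proof.
move=> /(cong_reduces f)/proj1/(_ (reduces_refl f)) red.
move: red; move E: [:: g] => w red.
by case: red E => [[]//|{}w v wv _ wE]; rewrite -wE in wv; case: (step_letter wv).
Qed.

End Words.

(** * The global object of sets of words *)

Section WordSets.
Variables (G : groupType) (P : pactSem G).

(** All sets of words are kept, and not only the congruence classes, so that no
    quotient has to be formed: the product below saturates under the congruence,
    and on two classes it is the class of the concatenation. *)
Definition word_set : Type := set (seq (letter P)).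

HB.instance Definition _ := gen_eqMixin word_set.
HB.instance Definition _ := gen_choiceMixin word_set.

Definition word_set_mul (U V : word_set) : word_set :=
  [set w | exists u v, [/\ U u, V v & cong w (u ++ v)]].

Lemma word_set_mulA : associative word_set_mul.
Proof.
move=> U V W; apply/seteqP; split=> t.
  move=> [u [vw [Uu [v [w [Vv Ww vwE]]] tE]]].
  exists (u ++ v), w; split=> //; first by exists u, v; split=> //; apply: rst_refl.
  by rewrite -catA; apply/(cong_trans tE)/cong_cat => //; apply: rst_refl.
move=> [uv [w [[u [v [Uu Vv uvE]]] Ww tE]]].
exists u, (v ++ w); split=> //; first by exists v, w; split=> //; apply: rst_refl.
by rewrite catA; apply/(cong_trans tE)/cong_cat => //; apply: rst_refl.
Qed.

HB.instance Definition _ := isSemigroup.Build word_set word_set_mulA.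

Definition word_set_act (x : G) (U : word_set) : word_set :=
  [set w | U (map (shift x^-1) w)].

Lemma word_set_act1 U : word_set_act 1 U = U.
Proof.
apply/funext => w; rewrite /word_set_act /mkset invg1.
by rewrite (eq_map (@shift1 G P)) map_id.
Qed.

Lemma word_set_act_comp x y U :
  word_set_act x (word_set_act y U) = word_set_act (x * y) U.
Proof.
apply/funext => w; rewrite /word_set_act /mkset -map_comp invgM.
by congr (U _); apply: eq_map => f /=; rewrite shiftM.
Qed.

Lemma word_set_actK x : cancel (word_set_act x) (word_set_act x^-1).
Proof. by move=> U; rewrite word_set_act_comp mulVg word_set_act1. Qed.

Lemma map_shiftK x : cancel (map (@shift G P x)) (map (shift x^-1)).
Proof.
by apply: mapK => f; rewrite shiftM mulVg shift1.
Qed.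

Lemma word_set_actM x (U V : word_set) :
  word_set_act x (U * V) = word_set_act x U * word_set_act x V.
Proof.
apply/seteqP; split=> w [u [v [Uu Vv wE]]].
  exists (map (shift x) u), (map (shift x) v).
  rewrite /word_set_act /mkset !map_shiftK; split=> //.
  rewrite -map_cat -[w](map_shiftK x^-1) invgK; exact: cong_shift.
exists (map (shift x^-1) u), (map (shift x^-1) v); split=> //.
by rewrite -map_cat; apply: cong_shift.
Qed.

Definition word_set_pact (x : G) (U : word_set) : option word_set :=
  Some (word_set_act x U).

Lemma word_set_partial : is_partial_action word_set_pact.
Proof.
split=> [U|x U V [<-]|x y U V W [<-] [<-]]; rewrite /word_set_pact.
- by rewrite word_set_act1.
- by rewrite word_set_actK.
- by rewrite word_set_act_comp.
Qed.

Lemma word_set_dom x U : pdom word_set_pact x U.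
Proof.
exists (word_set_act x^-1 U).
by rewrite /word_set_pact word_set_act_comp mulgV word_set_act1.
Qed.

Lemma word_set_subsg x : subsemigroup (pdom word_set_pact x).
Proof. by move=> *; apply: word_set_dom. Qed.

Lemma word_set_iso x :
  sg_iso (pdom word_set_pact x^-1) (pdom word_set_pact x) (word_set_pact x).
Proof.
split=> [U|U|U U' V [<-] [/(can_inj (word_set_actK x))] //|].
- by split=> _; [apply: word_set_dom | exists (word_set_act x U)].
- by split.
by move=> U U' V V' [<-] [<-]; rewrite /word_set_pact word_set_actM.
Qed.

Definition word_set_object : pactSem G :=
  PactSem word_set_partial word_set_subsg word_set_iso.

Definition to_word_set (a : P) : word_set_object :=
  [set w | cong w [:: pt 1 a]] : word_set.

Lemma to_word_setM : {morph to_word_set : a b / a * b}.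
Proof.
move=> a b.
have abE : cong [:: pt 1 a; pt 1 b] [:: pt 1 (a * b)].
  by apply/rst_step/step_head; exists 1, a, b.
apply/seteqP; split=> w.
  move=> wE; exists [:: pt 1 a], [:: pt 1 b].
  split; [exact: rst_refl | exact: rst_refl |].
  exact: cong_trans wE (cong_sym abE).
move=> [u [v [uE vE wE]]]; apply: (cong_trans wE).
exact: cong_trans (cong_cat uE vE) abE.
Qed.

HB.instance Definition _ :=
  isMultiplicative.Build P word_set_object to_word_set to_word_setM.

Lemma word_set_act_to x a :
  word_set_act x (to_word_set a) = [set w | cong w [:: pt x a]].
Proof.
apply/seteqP; split=> w.
  by move=> /(cong_shift x); rewrite -{1}[x]invgK map_shiftK /= shift_pt mulg1.
by move=> /(cong_shift x^-1); rewrite /= shift_pt mulVg.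
Qed.

(** If x moves the class of a into the image of S, then the points [pt x a] and
    [pt 1 b] coincide for some b, and this says that theta(x, a) = b. *)
Theorem globalization_of_compatible
    (hideal : forall x : G, two_sided_ideal (pdom (pact P) x))
    (hcompat : compatible P) : has_globalization P.
Proof.
have class_inj x y a b : [set w | cong w [:: pt x a]] =
    [set w | cong w [:: pt y b]] -> pact P (y^-1 * x) a = Some b.
  move=> E; apply/pt_eqP/(cong_letter hideal hcompat).
  have : [set w | cong w [:: pt x a]] [:: pt x a] by apply: rst_refl.
  by rewrite E.
have act_to x a b : pact P x a = Some b ->
    pact word_set_object x (to_word_set a) = Some (to_word_set b).
  move=> xab; rewrite /= /word_set_pact word_set_act_to.
  by have /pt_eqP -> : pact P (1^-1 * x) a = Some b by rewrite invg1 mul1g.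
exists word_set_object, to_word_set; split.
- by move=> x U; exists (word_set_act x U).
- exact: act_to.
- move=> a b /class_inj.
  by rewrite invg1 mulg1 (pact1 (pact_partial P)) => -[].
move=> x a; split=> [[b xab]|[_ [<-] [b _ /esym]]].
  by exists (to_word_set b); [apply: act_to | exists b].
rewrite word_set_act_to => /class_inj.
by rewrite invg1 mul1g; exists b.
Qed.

End WordSets.

(** * Sufficient conditions *)

Section Sufficient.
Variables (G : groupType) (P : pactSem G).
Hypothesis hideal : forall x : G, two_sided_ideal (pdom (pact P) x).

Lemma compatible1 (a b b' c e e' : P) :
  pact P 1 b = Some b' -> pact P 1 (a * b) = Some e ->
  pact P 1 e' = Some (b' * c) -> pact P 1 (a * e') = Some (e * c).
Proof.
by rewrite !(pact1 (pact_partial P)) => -[<-] [<-] [->]; rewrite mulgA.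
Qed.

Lemma compatible_idempotent :
  (forall x : G, x <> 1 -> idempotent_semigroup (pdom (pact P) x)) ->
  compatible P.
Proof.
move=> idem z a b b' c e e'.
have [-> | z1] := pselect (z = 1); first exact: compatible1.
have zinj := sg_iso_inj (pact_iso P z); have zM := sg_isoM (pact_iso P z).
have zV u v := pactV (pact_partial P) (x := z) (a := u) (b := v).
have zV1 : z^-1 <> 1 by move=> /(congr1 (@inv G)); rewrite invgK invg1.
move=> zb; have : pdom (pact P) z^-1 b by exists b'; apply: zV.
rewrite -(idem _ zV1) => -[b1 /(sg_iso_dom (pact_iso P z)) [b1' zb1]].
move=> [b2 /(sg_iso_dom (pact_iso P z)) [b2' zb2] b12].
have [a1 za1] := pact_idealr hideal a zb1.
have b'E : b' = b1' * b2' by have := zM _ _ _ _ zb1 zb2; rewrite b12 zb => -[].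
have [f zf] : exists f, pact P z f = Some (b2' * c).
  by apply: (proj2 (hideal _ _)); exists b2.
rewrite -b12 mulgA (zM _ _ _ _ za1 zb2) b'E -!mulgA => -[<-] ze'.
have -> : e' = b1 * f by apply: zinj ze' _; apply: zM.
by rewrite mulgA -[in RHS]mulgA; apply: zM.
Qed.

Lemma compatible_weakly_reductive :
  (forall x : G, x <> 1 -> weakly_reductive (pdom (pact P) x)) ->
  compatible P.
Proof.
move=> wred z a b b' c e e' zb ze ze'.
have [z1 | z1] := pselect (z = 1).
  by rewrite z1 in zb ze ze' *; apply: compatible1 zb ze ze'.
have zM := sg_isoM (pact_iso P z).
have [m zm] := pact_idealr hideal a ze'.
rewrite zm; congr Some; apply: (wred z z1).
- by exists (a * e').
- by apply: (proj2 (hideal _ _)); exists (a * b).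
move=> d Dd; have [d0 zd0] := Dd; split.
  (* Both sides equal theta_z(d0 a) b' c. *)
  have [a1 za1] : exists a1, pact P z (d0 * a) = Some a1.
    apply/(sg_iso_dom (pact_iso P z)); apply: (proj2 (hideal _ _)).
    by apply/(sg_iso_dom (pact_iso P z)); exists d.
  have := zM _ _ _ _ zd0 zm; have := zM _ _ _ _ zd0 ze.
  rewrite !mulgA (zM _ _ _ _ za1 zb) (zM _ _ _ _ za1 ze') => -[<-] [<-].
  by rewrite mulgA.
(* Both sides equal theta_z(a b f), where theta_z(f) = c d. *)
have [f zf] : exists f, pact P z f = Some (c * d) by apply: (proj1 (hideal _ _)).
have e'd : e' * d0 = b * f.
  have := zM _ _ _ _ zb zf; rewrite mulgA; apply: sg_iso_inj (pact_iso P z) _ _ _ _.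
  exact: zM.
have := zM _ _ _ _ zm zd0; have := zM _ _ _ _ ze zf.
by rewrite -!mulgA e'd => -> [].
Qed.

End Sufficient.

Section Ideals.
Variable S : semigroupType.
Implicit Type D : set S.

Lemma idempotent_of_factors D : two_sided_ideal D ->
  (forall a, D a -> exists b c, [/\ D b, D c & a = b * c]) ->
  idempotent_semigroup D.
Proof.
move=> idD facD; apply/seteqP; split=> [_ [a _ [b Db <-]]|a Da].
  exact: (proj1 (idD a _ Db)).
by have [b [c [Db Dc ->]]] := facD a Da; exists b => //; exists c.
Qed.

Lemma inverse_idempotent D : inverse_semigroup S -> two_sided_ideal D ->
  idempotent_semigroup D.
Proof.
move=> invS idD; apply: idempotent_of_factors => // a Da.
have [a' [[aa'a _] _]] := invS a.
exists a, (a' * a); split=> //; last by rewrite mulgA.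
exact: (proj1 (idD _ _ Da)).
Qed.

(** Let a', b' be the inverses of a, b; they lie in D, as a' = a' a a'.  Testing
    with c = a' and c = b' gives e := a a' = b a', f := b b' = a b' and
    b' a = b' b, whence e f = f and f e = e.  Hence e and f are both inverses of
    e, so e = f and a = e a = f a = b b' a = b b' b = b. *)
Lemma inverse_weakly_reductive D : inverse_semigroup S -> two_sided_ideal D ->
  weakly_reductive D.
Proof.
move=> invS idD a b Da Db ab.
have [a' [[aa'a a'aa'] _]] := invS a.
have [b' [[bb'b b'bb'] _]] := invS b.
have Da' : D a' by rewrite -a'aa'; apply/(proj2 (idD _ _ _))/(proj1 (idD _ _ Da)).
have Db' : D b' by rewrite -b'bb'; apply/(proj2 (idD _ _ _))/(proj1 (idD _ _ Db)).
have [_ eE] := ab _ Da'; have [b'E fE] := ab _ Db'.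
set e := a * a'; set f := b * b'.
have ef : e * f = f by rewrite /e /f -fE mulgA aa'a.
have fe : f * e = e by rewrite /e /f eE mulgA bb'b.
have ee : e * e = e by rewrite /e mulgA aa'a.
have [t [_ tuniq]] := invS e.
have te : t = e by apply: tuniq; rewrite !ee.
have tf : t = f by apply: tuniq; rewrite ef fe ef.
have e_eq_f : e = f by rewrite -te.
by rewrite -aa'a -/e e_eq_f /f -mulgA b'E mulgA.
Qed.

Lemma unital_idempotent D : unital D -> two_sided_ideal D ->
  idempotent_semigroup D.
Proof.
move=> [e De eP] idD; apply: idempotent_of_factors => // a Da.
by exists e, a; split=> //; rewrite (proj1 (eP a Da)).
Qed.

Lemma unital_weakly_reductive D : unital D -> weakly_reductive D.
Proof.
move=> [e De eP] a b Da Db /(_ e De)[].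
by rewrite (proj1 (eP a Da)) (proj1 (eP b Db)).
Qed.

End Ideals.

Theorem corollary5p4 (G : groupType) (P : pactSem G)
    (hideal : forall x : G, two_sided_ideal (pdom (pact P) x)) :
  [/\ (forall x : G, x <> 1 -> idempotent_semigroup (pdom (pact P) x)) ->
        has_globalization P,
      (forall x : G, x <> 1 -> weakly_reductive (pdom (pact P) x)) ->
        has_globalization P,
      inverse_semigroup P ->
        (forall x : G, x <> 1 -> idempotent_semigroup (pdom (pact P) x)) /\
        (forall x : G, x <> 1 -> weakly_reductive (pdom (pact P) x)) &
      (forall x : G, unital (pdom (pact P) x)) ->
        (forall x : G, x <> 1 -> idempotent_semigroup (pdom (pact P) x)) /\
        (forall x : G, x <> 1 -> weakly_reductive (pdom (pact P) x))].
Proof.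
split=> [idem|wred|invP|unitP].
- exact/globalization_of_compatible/compatible_idempotent.
- exact/globalization_of_compatible/compatible_weakly_reductive.
- split=> x _; first exact: inverse_idempotent.
  exact: inverse_weakly_reductive.
- split=> x _; first exact: unital_idempotent.
  exact: unital_weakly_reductive.
Qed.
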